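(* Let $(L,[-,-,-])$ be a ternary Leibniz algebra and $\beta:L\to L$ an injective averaging operator on $L$. Then $L$, endowed with the new multiplication $[-,-,-]_\beta:L\times L\times L\to L$ defined by $$[x,y,z]_\beta:=[\beta(x),\beta(y),z]$$ for all $x,y,z\in L$, is a ternary Leibniz algebra.
   Context: Vector spaces are over a field $\mathbb{K}$. A ternary Leibniz algebra is a vector space $L$ with a trilinear map $[-,-,-]:L\times L\times L\to L$ such that $[[x,y,z],t,u]=[x,y,[z,t,u]]+[x,[y,t,u],z]+[[x,t,u],y,z]$ for all $x,y,z,t,u\in L$. An averaging operator on $L$ is a linear map $\beta:L\to L$ such that for all $x,y,z\in L$ $$\beta([\beta(x),\beta(y),z])=\beta([\beta(x),y,\beta(z)])=\beta([x,\beta(y),\beta(z)])=[\beta(x),\beta(y),\beta(z)].$$ *)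

(* Defs.v *)
From mathcomp Require Import all_boot all_algebra.

Set Implicit Arguments.
Unset Strict Implicit.
Unset Printing Implicit Defensive.

Import GRing.Theory.
Local Open Scope ring_scope.

Section TernaryLeibniz.

Variables (K : fieldType) (L : lmodType K).
Implicit Types (br : L -> L -> L -> L) (beta : {linear L -> L}).

Definition trilinear br : Prop :=
  [/\ forall y z, linear (fun x => br x y z),
      forall x z, linear (fun y => br x y z)
    & forall x y, linear (fun z => br x y z)].

Definition ternary_leibniz_identity br : Prop :=
  forall x y z t u : L,
    br (br x y z) t u =
      br x y (br z t u) + br x (br y t u) z + br (br x t u) y z.

Definition ternary_leibniz_algebra br : Prop :=
  trilinear br /\ ternary_leibniz_identity br.

Definition averaging_operator br beta : Prop :=
  forall x y z : L,
    [/\ beta (br (beta x) (beta y) z) = beta (br (beta x) y (beta z)),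
        beta (br (beta x) y (beta z)) = beta (br x (beta y) (beta z))
      & beta (br x (beta y) (beta z)) = br (beta x) (beta y) (beta z)].

Definition twisted_bracket br beta : L -> L -> L -> L :=
  fun x y z => br (beta x) (beta y) z.

End TernaryLeibniz.

(* Main.v *)
Require Import Defs.
From mathcomp Require Import all_boot all_algebra.

Set Implicit Arguments.
Unset Strict Implicit.
Unset Printing Implicit Defensive.

Import GRing.Theory.
Local Open Scope ring_scope.

(** Write [x, y, z] for the bracket and b for the operator.  The averaging law
    gives [b x, b y, z], [b x, y, b z] and [x, b y, b z] the same image
    [b x, b y, b z] under b.  As b is injective, these three elements are
    already equal: a bracket with b applied to two of its arguments does not
    depend on which argument is left bare ([averaging_inj12_13],
    [averaging_inj12_23]).

    The left-hand side of the twisted Leibniz identity is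
    [[b x, b y, b z], b t, u], by [averaging_twisted].  The original identity
    expands it into
    [b x, b y, [b z, b t, u]] + [b x, [b y, b t, u], b z]
    + [[b x, b t, u], b y, b z].
    The first term is as required; in the other two the bare argument is the
    inner bracket, and moving the bare position to z gives the twisted terms. *)

Section Averaging.

Variables (K : fieldType) (L : lmodType K).
Variables (br : L -> L -> L -> L) (beta : {linear L -> L}).

Lemma trilinear_twisted_bracket :
  trilinear br -> trilinear (twisted_bracket br beta).
Proof.
move=> [lin1 lin2 lin3]; split=> [y z a u v|x z a u v|x y].
- by rewrite /twisted_bracket linearP lin1.
- by rewrite /twisted_bracket linearP lin2.
- exact: lin3.
Qed.

Hypothesis avg : averaging_operator br beta.

Lemma averaging_twisted x y z :
  beta (twisted_bracket br beta x y z) = br (beta x) (beta y) (beta z).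
Proof. by have [-> -> ->] := avg x y z. Qed.

Hypothesis beta_inj : injective beta.

Lemma averaging_inj12_13 x y z :
  br (beta x) (beta y) z = br (beta x) y (beta z).
Proof. by apply: beta_inj; have [] := avg x y z. Qed.

Lemma averaging_inj12_23 x y z :
  br (beta x) (beta y) z = br x (beta y) (beta z).
Proof. by apply: beta_inj; have [-> ->] := avg x y z. Qed.

End Averaging.

Theorem lemma3p4 (K : fieldType) (L : lmodType K) (br : L -> L -> L -> L)
    (beta : {linear L -> L}) :
  ternary_leibniz_algebra br ->
  averaging_operator br beta ->
  injective beta ->
  ternary_leibniz_algebra (twisted_bracket br beta).
Proof.
move=> [lin leib] avg inj; split; first exact: trilinear_twisted_bracket.
move=> x y z t u; rewrite {1}/twisted_bracket (averaging_twisted avg) leib.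
rewrite -(averaging_inj12_13 avg inj x _ z).
by rewrite -(averaging_inj12_23 avg inj _ y z).
Qed.
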